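(* Let $H=(V,E,C,\ell)$ be an edge-colored hypergraph with nonnegative edge weights $w$. Let $\{a_e,b_e,a_u^i,b_u^i\}$ be an optimal solution of the binary linear program $\text{BLP}_\text{CP}$, and for each $e\in E$ define $x_e=\tfrac12(b_e-a_e+1)$. Then $\{x_e\}_{e\in E}$ is an optimal solution of $\text{LP}_\text{VC}$ (in particular the optimal values of $\text{BLP}_\text{CP}$ and $\text{LP}_\text{VC}$ coincide).
   Context: An edge-colored hypergraph $H=(V,E,C,\ell)$ has node set $V$, hyperedge set $E$, color set $C=\{1,\dots,k\}$, and color map $\ell:E\to C$; weights $w(e)\ge0$. For $u\in V$, $C(u)=\{j\in C:\exists e\ni u\text{ with }\ell(e)=j\}$ and $\binom{C(u)}{2}$ is the set of unordered pairs of distinct colors in $C(u)$. A pair $(e,f)$ of hyperedges is a bad edge pair if $e\cap f\ne\emptyset$ and $\ell(e)\ne\ell(f)$; $\mathcal{B}$ is the set of bad edge pairs. $\text{LP}_\text{VC}$: minimize $\sum_{e\in E}w(e)x_e$ subject to $x_e+x_f\ge1$ for all $(e,f)\in\mathcal{B}$, and $x_e\ge0$ for all $e\in E$. $\text{BLP}_\text{CP}$: minimize $\tfrac12\sum_{e\in E}w(e)(b_e-a_e+1)$ subject to: for all $e\in E$ and $u\in e$, $a_e\le a_u^{\ell(e)}$ and $b_u^{\ell(e)}\le b_e$; for all $u\in V$ and $(i,j)\in\binom{C(u)}{2}$, $a_u^i\le b_u^j$ and $a_u^j\le b_u^i$; all variables $a_u^i,b_u^i$ ($u\in V$, $i\in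 C(u)$) and $a_e,b_e$ ($e\in E$) are in $\{0,1\}$. *)

(* Defs.v *)
From HB Require Import structures.
From mathcomp Require Export all_boot all_order all_algebra.

Set Implicit Arguments.
Unset Strict Implicit.
Unset Printing Implicit Defensive.

Import GRing.Theory Num.Theory.
Local Open Scope ring_scope.

(* Hyperedges are names, with [nodes] giving the underlying node sets, so
   parallel hyperedges are allowed; a hypergraph whose hyperedges are subsets
   of V is the case where [nodes] is injective. Color j of {1, ..., k} is
   encoded as j - 1 : 'I_k. *)
Record ec_hypergraph := ECHypergraph {
  hnode : finType;
  hedge : finType;
  ncolor : nat;
  nodes : hedge -> {set hnode};
  color : hedge -> 'I_ncolor }.

Definition node_colors (H : ec_hypergraph) (u : hnode H) : {set 'I_(ncolor H)} :=
  [set j | [exists e : hedge H, (u \in nodes e) && (color e == j)]].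

Definition bad_edge_pair (H : ec_hypergraph) (e f : hedge H) : Prop :=
  nodes e :&: nodes f <> set0 /\ color e <> color f.

Section Minimization.
Variables (R : numDomainType) (T : Type).
Variables (feasible : T -> Prop) (objective : T -> R).

Definition is_optimal (s : T) : Prop :=
  feasible s /\ forall t, feasible t -> objective s <= objective t.

Definition is_optimal_value (v : R) : Prop :=
  exists s, is_optimal s /\ objective s = v.
End Minimization.

Section Programs.
Variables (R : realFieldType) (H : ec_hypergraph) (w : hedge H -> R).

Definition vc_feasible (x : hedge H -> R) : Prop :=
  (forall e f : hedge H, bad_edge_pair e f -> 1 <= x e + x f) /\
  (forall e : hedge H, 0 <= x e).

Definition vc_objective (x : hedge H -> R) : R :=
  \sum_(e : hedge H) w e * x e.

Definition vc_optimal : (hedge H -> R) -> Prop :=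
  is_optimal vc_feasible vc_objective.

Definition vc_optimal_value : R -> Prop :=
  is_optimal_value vc_feasible vc_objective.

(* The node variables [a_node u i] and [b_node u i] exist in the program only
   for i in C(u); their values at other colors are junk that neither the
   constraints nor the objective look at. *)
Record cp_vars := CPVars {
  a_edge : hedge H -> R;
  b_edge : hedge H -> R;
  a_node : hnode H -> 'I_(ncolor H) -> R;
  b_node : hnode H -> 'I_(ncolor H) -> R }.

Definition is_binary (r : R) : Prop := r = 0 \/ r = 1.

Definition cp_feasible (s : cp_vars) : Prop :=
  [/\ forall (e : hedge H) (u : hnode H), u \in nodes e ->
        a_edge s e <= a_node s u (color e) /\
        b_node s u (color e) <= b_edge s e,
      forall (u : hnode H) (i j : 'I_(ncolor H)),
        i \in node_colors u -> j \in node_colors u -> i <> j ->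
        a_node s u i <= b_node s u j /\ a_node s u j <= b_node s u i,
      forall (u : hnode H) (i : 'I_(ncolor H)), i \in node_colors u ->
        is_binary (a_node s u i) /\ is_binary (b_node s u i) &
      forall e : hedge H, is_binary (a_edge s e) /\ is_binary (b_edge s e)].

Definition cp_objective (s : cp_vars) : R :=
  2^-1 * \sum_(e : hedge H) w e * (b_edge s e - a_edge s e + 1).

Definition cp_optimal : cp_vars -> Prop :=
  is_optimal cp_feasible cp_objective.

Definition cp_optimal_value : R -> Prop :=
  is_optimal_value cp_feasible cp_objective.
End Programs.

(* Main.v *)
Require Import Defs.
From mathcomp Require Import all_boot all_order all_algebra.
From mathcomp Require Import lra.

Set Implicit Arguments.
Unset Strict Implicit.
Unset Printing Implicit Defensive.

Import Order.TTheory GRing.Theory Num.Theory.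
Local Open Scope ring_scope.

(** The map (a, b) |-> (b - a + 1) / 2 sends feasible points of BLP_CP to
    feasible points of LP_VC with the same objective, so it suffices to bound
    the optimum of BLP_CP by the objective of any feasible x of LP_VC.
    Truncate x at 1 and, for a threshold t in [0, 1], put a_e = [x_e <= t] and
    b_e = [1 - x_e <= t]. If (e, f) is bad then 1 - x_f <= x_e, hence
    a_e <= b_f, and this is all that is needed to choose the node variables.
    When t is uniform in [0, 1], the means of a_e and b_e are 1 - x_e and x_e,
    so the mean objective is that of x and some threshold does at least as
    well. Since only finitely many breakpoints matter, the mean is computed as
    a left Riemann sum over them. *)

Section LeftRiemannSum.
Variable R : realFieldType.
Implicit Types (x c k : R) (p : seq R) (f g : R -> R).

Fixpoint left_sum f x p : R :=
  if p is y :: p' then (y - x) * f x + left_sum f y p' else 0.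

Lemma left_sumD f g x p :
  left_sum (fun t => f t + g t) x p = left_sum f x p + left_sum g x p.
Proof. by elim: p x => [|y p IHp] x /=; rewrite ?addr0 // IHp; lra. Qed.

Lemma left_sumZ k f x p :
  left_sum (fun t => k * f t) x p = k * left_sum f x p.
Proof. by elim: p x => [|y p IHp] x /=; rewrite ?mulr0 // IHp; lra. Qed.

Lemma left_sum_cst k x p : left_sum (fun=> k) x p = k * (last x p - x).
Proof. by elim: p x => [|y p IHp] x /=; rewrite ?IHp; lra. Qed.

Lemma left_sum_sum (I : finType) (F : I -> R -> R) x p :
  left_sum (fun t => \sum_i F i t) x p = \sum_i left_sum (F i) x p.
Proof.
elim: p x => [|y p IHp] x /=; first by rewrite big1.
by rewrite IHp mulr_sumr -big_split.
Qed.

(** The left sum is exact here because the jump at [c] falls on a breakpoint and the indicator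
    already takes the value 1 there. *)
Lemma left_sum_step c x p : path <=%R x p -> c \in x :: p ->
  left_sum (fun t => (c <= t)%R%:R) x p = last x p - c.
Proof.
elim: p x => [|y p IHp] x /=; first by rewrite inE => _ /eqP->; rewrite subrr.
move=> /andP[le_xy path_p]; rewrite inE.
have le_x_yp z : z \in y :: p -> x <= z.
  rewrite inE => /orP[/eqP->//|z_in]; apply: le_trans le_xy _.
  by move: path_p; rewrite (path_sortedE le_trans) => /andP[/allP/(_ z z_in)].
case: (eqVneq c x) => [->|neq_cx] /= c_in.
  rewrite lexx mulr1; suff -> : left_sum (fun t => (x <= t)%R%:R) y p = last y p - y.
    by lra.
  (* Every breakpoint from [y] on is at least [x], so the indicator agrees with the constant 1 on
     them. *)
  have := left_sum_cst 1 y p; rewrite mul1r => <-.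
  elim: p y {IHp c_in} le_xy path_p {le_x_yp} => //= z p IHp y le_xy.
  by move=> /andP[le_yz path_p]; rewrite le_xy IHp // (le_trans le_xy).
have lt_xc : x < c by rewrite lt_neqAle eq_sym neq_cx le_x_yp.
by rewrite leNgt lt_xc /= mulr0 add0r IHp.
Qed.

Lemma le_left_sum_ex f x p : path <=%R x p ->
  exists t, f t * (last x p - x) <= left_sum f x p.
Proof.
elim: p x => [|y p IHp] x /=; first by exists x; rewrite subrr mulr0.
move=> /andP[le_xy path_p]; have [t le_t] := IHp y path_p.
have le_y_last : y <= last y p.
  case: p path_p {IHp le_t} => //= z p path_p.
  move: path_p; rewrite -[_ && _]/(path <=%R y (z :: p)).
  rewrite (path_sortedE le_trans) => /andP[/allP le_y _].
  by apply: le_y; rewrite mem_last.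
(* Both lengths [y - x] and [last y p - y] are nonnegative, so the smaller of [f x] and [f t] serves
   for the whole path. *)
by case: (leP (f x) (f t)) => cmp; [exists x | exists t]; nra.
Qed.

End LeftRiemannSum.

Section Programs.
Variables (R : realFieldType) (H : ec_hypergraph) (w : hedge H -> R).
Implicit Types (x : hedge H -> R) (s : cp_vars R H).

Lemma vc_objective_half s :
  vc_objective w (fun e => 2^-1 * (b_edge s e - a_edge s e + 1)) =
  cp_objective w s.
Proof.
rewrite /vc_objective /cp_objective mulr_sumr.
by apply: eq_bigr => e _; rewrite mulrCA.
Qed.

Lemma bad_edge_pairP (e f : hedge H) : bad_edge_pair e f ->
  exists u, [/\ u \in nodes e, u \in nodes f & color e <> color f].
Proof.
move=> [/eqP/set0Pn[u]]; rewrite inE => /andP[ue uf] neq_c.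
by exists u; split.
Qed.

Lemma mem_node_colors (e : hedge H) u :
  u \in nodes e -> color e \in node_colors u.
Proof. by move=> ue; rewrite inE; apply/existsP; exists e; rewrite ue eqxx. Qed.

Lemma cp_feasible_half s : cp_feasible s ->
  vc_feasible (fun e => 2^-1 * (b_edge s e - a_edge s e + 1)).
Proof.
move=> [edge_node node_node _ edge_bin]; split=> [e f bad_ef|e].
  have [u [ue uf neq_c]] := bad_edge_pairP bad_ef.
  have [ae be] := edge_node _ _ ue; have [af bf] := edge_node _ _ uf.
  have [aebf afbe] := node_node _ _ _ (mem_node_colors ue)
    (mem_node_colors uf) neq_c.
  (* Through the shared node, [a_edge s e <= b_edge s f] and [a_edge s f <= b_edge s e]; their sum
     gives the covering constraint. *)
  by lra.
by have [[-> [->|->]|-> [->|->]]] := edge_bin e; lra.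
Qed.

(** The node values are the tightest that the edge constraints allow: the maximum of [a] and the
    minimum of [b] over the hyperedges of color [i] at [u]. *)
Definition cp_of_edges (a b : pred (hedge H)) : cp_vars R H :=
  CPVars (fun e => (a e)%:R) (fun e => (b e)%:R)
    (fun u i => [exists e, [&& u \in nodes e, color e == i & a e]]%:R)
    (fun u i => [forall e, (u \in nodes e) && (color e == i) ==> b e]%:R).

Lemma is_binary_bool (c : bool) : is_binary (c%:R : R).
Proof. by case: c; [right | left]. Qed.

Lemma cp_of_edges_feasible (a b : pred (hedge H)) :
  (forall e f, bad_edge_pair e f -> a e -> b f) ->
  cp_feasible (cp_of_edges a b).
Proof.
move=> ab_bad.
have le_bool (c d : bool) : (c -> d) -> (c%:R : R) <= d%:R.
  by rewrite ler_nat; case: c d => [] [] // /(_ isT).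
have node_le u i j : i <> j ->
    a_node (cp_of_edges a b) u i <= b_node (cp_of_edges a b) u j.
  move=> neq_ij; apply: le_bool => /existsP[e /and3P[ue /eqP ci ae]].
  apply/forallP => f; apply/implyP => /andP[uf /eqP cj].
  apply: ab_bad ae; split; last by rewrite ci cj.
  by apply/eqP/set0Pn; exists u; rewrite inE ue.
split=> [e u ue|u i j _ _ neq_ij|u i _|e].
- split; apply: le_bool; last by move/forallP/(_ e); rewrite ue eqxx.
  by move=> ae; apply/existsP; exists e; rewrite ue eqxx.
- by split; apply: node_le => // /esym.
- by split; apply: is_binary_bool.
- by split; apply: is_binary_bool.
Qed.

(** If one term of a pair is cut to 1, the other is nonnegative, so the sum still reaches 1. *)
Lemma vc_feasible_min1 x :
  vc_feasible x -> vc_feasible (fun e => Num.min (x e) 1).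
Proof.
move=> [x_bad x_ge0]; split=> [e f /x_bad ge1|e].
  by have := x_ge0 e; have := x_ge0 f; case: (leP (x e)); case: (leP (x f)); lra.
by have := x_ge0 e; case: (leP (x e) 1); lra.
Qed.

Lemma cp_rounding_le1 x : vc_feasible x -> (forall e, x e <= 1) ->
  exists2 s, cp_feasible s & cp_objective w s <= vc_objective w x.
Proof.
move=> [x_bad x_ge0] x_le1.
(* [q] holds every jump of the two families of indicators; the 1 appended in [p] makes the total
   length from 0 equal to 1. *)
pose q := sort <=%R ([seq x e | e : hedge H] ++ [seq 1 - x e | e : hedge H]).
pose p := rcons q 1.
have q01 z : z \in q -> 0 <= z <= 1.
  rewrite mem_sort mem_cat => /orP[] /mapP[e _ ->];
  by have := x_ge0 e; have := x_le1 e; lra.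
have path_p : path <=%R 0 p.
  rewrite rcons_path (path_sortedE le_trans) sort_sorted; last exact: le_total.
  rewrite andbT; apply/andP; split; first by apply/allP => z /q01/andP[].
  have := mem_last 0 q; rewrite inE => /orP[/eqP->|/q01/andP[]//].
  exact: ler01.
have last_p : last 0 p = 1 by rewrite last_rcons.
have in_p z : z \in q -> z \in 0 :: p.
  by move=> zq; rewrite inE mem_rcons inE zq !orbT.
have xp e : x e \in 0 :: p.
  by apply: in_p; rewrite mem_sort mem_cat map_f // mem_enum.
have xp' e : 1 - x e \in 0 :: p.
  apply: in_p; rewrite mem_sort mem_cat orbC.
  by rewrite (map_f (fun e => 1 - x e)) // mem_enum.
pose F t : R := \sum_e w e * ((1 - x e <= t)%R%:R + (-1) * (x e <= t)%R%:R + 1).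
(* Each hyperedge contributes [w e] times [x e - (1 - x e) + 1 = 2 * x e]. *)
have mean_F : left_sum F 0 p = 2 * vc_objective w x.
  rewrite left_sum_sum /vc_objective mulr_sumr; apply: eq_bigr => e _.
  rewrite left_sumZ !left_sumD left_sumZ left_sum_cst !left_sum_step //.
  by rewrite last_p; lra.
have [t] := le_left_sum_ex F path_p; rewrite last_p subr0 mulr1 mean_F => le_t.
exists (cp_of_edges (fun e => x e <= t) (fun e => 1 - x e <= t)).
  by apply: cp_of_edges_feasible => e f /x_bad; lra.
rewrite /cp_objective (eq_bigr (fun e =>
  w e * ((1 - x e <= t)%R%:R + (-1) * (x e <= t)%R%:R + 1))) => [|e _].
  by rewrite -/(F t); lra.
by rewrite mulN1r.
Qed.

Lemma cp_rounding x : (forall e, 0 <= w e) -> vc_feasible x ->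
  exists2 s, cp_feasible s & cp_objective w s <= vc_objective w x.
Proof.
move=> w_ge0 /vc_feasible_min1 /cp_rounding_le1[e|s s_feas s_le].
  by rewrite ge_min lexx orbT.
(* Truncation only lowers the objective, as the weights are nonnegative. *)
exists s => //; apply: le_trans s_le _; apply: ler_sum => e _.
by apply: ler_wpM2l => //; rewrite ge_min lexx.
Qed.

End Programs.

Theorem theorem3 (R : realFieldType) (H : ec_hypergraph) (w : hedge H -> R)
    (w_ge0 : forall e : hedge H, 0 <= w e)
    (s : cp_vars R H) (s_opt : cp_optimal w s) :
  vc_optimal w (fun e : hedge H => 2^-1 * (b_edge s e - a_edge s e + 1)) /\
  (exists v : R, cp_optimal_value w v /\ vc_optimal_value w v).
Proof.
have vc_opt :
    vc_optimal w (fun e : hedge H => 2^-1 * (b_edge s e - a_edge s e + 1)).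
  have [s_feas s_min] := s_opt.
  (* [r] rounds the competitor [x], and [s] costs at most as much as [r]. *)
  split=> [|x /(cp_rounding w_ge0)[r /s_min r_ge r_le]].
    exact: cp_feasible_half.
  by rewrite vc_objective_half (le_trans r_ge).
split=> //; exists (cp_objective w s); split; first by exists s.
by eexists; split; [exact: vc_opt | exact: vc_objective_half].
Qed.
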